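(* Fix $\tau$ with $\tfrac{1}{\sqrt2}+\tfrac12\le\tau<\tfrac32$. Let $S_Q^{(\tau)}$ denote the maximal quantum value of the Bell expression $S^{(\tau)}$, i.e. the supremum of $S^{(\tau)}$ over all bipartite quantum states $\rho$ of arbitrary finite local dimension and all local two-outcome measurements $\{A_x^a\}_{a=0,1}$ ($x=0,1$) for Alice and $\{B_y^b\}_{b=0,1}$ ($y=0,1$) for Bob, where $p(a,b|x,y)=\mathrm{tr}(\rho\,A_x^a\otimes B_y^b)$. Then for no finite $d$ does there exist a choice of local measurements such that the maximally entangled state $|\Psi_d^+\rangle=\frac{1}{\sqrt d}\sum_{j=1}^d|j\rangle_A|j\rangle_B$ attains $S^{(\tau)}=S_Q^{(\tau)}$; that is, no finite-dimensional maximally entangled state violates the inequality $S^{(\tau)}\le 0$ maximally.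
   Context: Two parties, Alice and Bob, each choose one of two measurements ($x\in\{0,1\}$ for Alice, $y\in\{0,1\}$ for Bob) with outcomes $a,b\in\{0,1\}$; $p(a,b|x,y)$ is the joint probability of outcomes $a,b$ given settings $x,y$, and $p_A(a|x)$, $p_B(b|y)$ are the marginals. For a real parameter $\tau\ge1$ the Bell expression is $S^{(\tau)}=\sum_{x,y,a,b\in\{0,1\}}\beta_{xy}^{ab}\,p(a,b|x,y)$ with $\beta_{01}^{00}=\beta_{10}^{00}=1-\tau$, $\beta_{01}^{01}=\beta_{10}^{10}=-\tau$, $\beta_{00}^{00}=1$, $\beta_{11}^{00}=-1$, and all other $\beta_{xy}^{ab}=0$. Explicitly, $S^{(\tau)}=p(0,0|0,0)-p(0,0|1,1)+(1-\tau)[p(0,0|0,1)+p(0,0|1,0)]-\tau[p(0,1|0,1)+p(1,0|1,0)]$. Separable states satisfy $S^{(\tau)}\le0$ (the Bell inequality $I^{(\tau)}$); for $\tau=1$ it is the Clauser–Horne inequality. ''Violating maximally'' means achieving the maximal quantum value $S_Q^{(\tau)}$ (which is strictly positive for $1\le\tau<3/2$). *)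

(* Defs.v *)
From HB Require Import structures.
From mathcomp Require Import all_boot all_order all_algebra.
Set Implicit Arguments. Unset Strict Implicit. Unset Printing Implicit Defensive.
Import Order.TTheory GRing.Theory Num.Theory.
Local Open Scope ring_scope.

Section Q.
Variable C : numClosedFieldType.

Definition adj (m n : nat) (A : 'M[C]_(m, n)) : 'M[C]_(n, m) :=
  \matrix_(i, j) (A j i)^*.

Definition psd (n : nat) (A : 'M[C]_n) : Prop :=
  adj A = A /\ forall v : 'cV[C]_n, 0 <= (adj v *m A *m v) 0 0.

Definition is_state (n : nat) (rho : 'M[C]_n) : Prop :=
  psd rho /\ \tr rho = 1.

Definition is_meas (n : nat) (M : 'I_2 -> 'M[C]_n) : Prop :=
  (forall a, psd (M a)) /\ \sum_(a < 2) M a = 1%:M.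

(* splitting an index of C^m (x) C^n into its two components
   (the same ordering as mxvec_index) *)
Definition split_idx (m n : nat) (k : 'I_(m * n)) : 'I_m * 'I_n :=
  enum_val (cast_ord (esym (mxvec_cast m n)) k).

Definition tens (m n : nat) (A : 'M[C]_m) (B : 'M[C]_n) : 'M[C]_(m * n) :=
  \matrix_(k, l) (A (split_idx k).1 (split_idx l).1 * B (split_idx k).2 (split_idx l).2).

Definition behav (m n : nat) (rho : 'M[C]_(m * n))
  (A : 'I_2 -> 'I_2 -> 'M[C]_m) (B : 'I_2 -> 'I_2 -> 'M[C]_n)
  (a b x y : 'I_2) : C :=
  \tr (rho *m tens (A x a) (B y b)).

(* The Bell expression S^(tau); p a b x y = p(a,b|x,y) *)
Definition S_tau (tau : C) (p : 'I_2 -> 'I_2 -> 'I_2 -> 'I_2 -> C) : C :=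
  let o := (0 : 'I_2) in let l := (1 : 'I_2) in
  p o o o o - p o o l l
  + (1 - tau) * (p o o o l + p o o l o)
  - tau * (p o l o l + p l o l o).

Definition quantum_value (tau s : C) : Prop :=
  exists (m n : nat) (rho : 'M[C]_(m * n))
         (A : 'I_2 -> 'I_2 -> 'M[C]_m) (B : 'I_2 -> 'I_2 -> 'M[C]_n),
    is_state rho /\ (forall x, is_meas (A x)) /\ (forall y, is_meas (B y)) /\
    s = S_tau tau (behav rho A B).

Definition is_SQ (tau s : C) : Prop :=
  quantum_value tau s /\ forall s', quantum_value tau s' -> s' <= s.

Definition maxent_vec (d : nat) : 'cV[C]_(d * d) :=
  \col_k (if (split_idx k).1 == (split_idx k).2 then (sqrtC d%:R)^-1 else 0).

Definition maxent (d : nat) : 'M[C]_(d * d) :=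
  maxent_vec d *m adj (maxent_vec d).

End Q.

(* Main.v *)
(* On the maximally entangled state p(a,b|x,y) = tr(A B^T)/d, so with effects
   X = A_0^0, X' = A_1^0, Y = (B_0^0)^T, Y' = (B_1^0)^T the Bell value is
     (tr(XY + XY' + X'Y - X'Y') - tau tr(X + Y)) / d.
   For tau >= 1/sqrt 2 + 1/2 this is nonpositive by a cubic sum of squares: with
   r = sqrt 2 and projective effects,
     4 (1+r) [(r+1)/2 tr(X + Y) - tr(XY + XY' + X'Y - X'Y')]
       = tr X (1+r - rY - rY')^2 + 2 tr X (1+r/2 - X' - rY')^2
       + tr Y (1+r - rX - rX')^2 + 2 tr Y (1+r/2 - Y' - rX')^2
       + 2(1+r) [tr X' (X - (r-1)Y - Y')^2 + tr Y' (Y - (r-1)X - X')^2],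
   and passing to general effects only helps because P - P^2 >= 0.
   For tau < 3/2 a weakly entangled two-qubit state of Hardy type has a strictly
   positive Bell value, so the maximum is not attained at a maximally entangled
   state. *)
Require Import Defs.
From HB Require Import structures.
From mathcomp Require Import all_boot all_order all_algebra.
From mathcomp Require Import ring.
Import Order.TTheory GRing.Theory Num.Theory.
Local Open Scope ring_scope.
Set Implicit Arguments.
Unset Strict Implicit.

(** * Adjoints, positive semidefinite matrices and effects *)

Definition effect (C : numClosedFieldType) (n : nat) (X : 'M[C]_n) : Prop :=
  psd X /\ psd (1%:M - X).

Definition vecmx (C : numClosedFieldType) (m n : nat) (M : 'M[C]_(m, n)) :
    'cV[C]_(m * n) :=
  \col_k M (split_idx k).1 (split_idx k).2.

Lemma adjE (C : numClosedFieldType) (m n : nat) (A : 'M[C]_(m, n)) :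
  adj A = map_mx Num.conj (A^T).
Proof. by apply/matrixP => i j; rewrite !mxE. Qed.

Lemma adjK (C : numClosedFieldType) (m n : nat) (A : 'M[C]_(m, n)) :
  adj (adj A) = A.
Proof. by apply/matrixP => i j; rewrite !mxE conjCK. Qed.

Lemma adj1 (C : numClosedFieldType) (n : nat) : adj (1%:M : 'M[C]_n) = 1%:M.
Proof. by rewrite adjE trmx1 map_mx1. Qed.

Lemma adjD (C : numClosedFieldType) (m n : nat) (A B : 'M[C]_(m, n)) :
  adj (A + B) = adj A + adj B.
Proof. by rewrite !adjE linearD /= map_mxD. Qed.

Lemma adjZ (C : numClosedFieldType) (m n : nat) (c : C) (A : 'M[C]_(m, n)) :
  adj (c *: A) = c^* *: adj A.
Proof. by rewrite !adjE linearZ /= map_mxZ. Qed.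

Lemma adjM (C : numClosedFieldType) (m n p : nat) (A : 'M[C]_(m, n))
    (B : 'M[C]_(n, p)) :
  adj (A *m B) = adj B *m adj A.
Proof. by rewrite !adjE trmx_mul map_mxM. Qed.

Lemma psd_congr (C : numClosedFieldType) (m n : nat) (X : 'M[C]_m)
    (A : 'M[C]_(m, n)) :
  psd X -> psd (adj A *m X *m A).
Proof.
case=> aX pX; split; first by rewrite !adjM adjK aX mulmxA.
by move=> v; have := pX (A *m v); rewrite adjM !mulmxA.
Qed.

Lemma psd_gram (C : numClosedFieldType) (m n : nat) (A : 'M[C]_(m, n)) :
  psd (adj A *m A).
Proof.
rewrite -[adj A]mulmx1; apply: psd_congr; split; first exact: adj1.
move=> v; rewrite mulmx1 mxE sumr_ge0 // => i _.
by rewrite mxE mulrC mul_conjC_ge0.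
Qed.

Lemma psdD (C : numClosedFieldType) (n : nat) (A B : 'M[C]_n) :
  psd A -> psd B -> psd (A + B).
Proof.
move=> [aA pA] [aB pB]; split; first by rewrite adjD aA aB.
by move=> v; rewrite mulmxDr mulmxDl mxE addr_ge0.
Qed.

(** The form of [A^T] at [v] is the form of [A] at the conjugate of [v], since a 1 x 1 matrix equals
    its transpose. *)
Lemma psd_tr (C : numClosedFieldType) (n : nat) (A : 'M[C]_n) :
  psd A -> psd A^T.
Proof.
case=> aA pA; split.
  by rewrite -[in RHS]aA; apply/matrixP => i j; rewrite !mxE.
move=> v; have := pA (map_mx Num.conj v); congr (is_true (0 <= _)).
transitivity ((adj (map_mx Num.conj v) *m A *m map_mx Num.conj v)^T 0 0).
  by rewrite [RHS]mxE.
rewrite !trmx_mul mulmxA; congr ((_ *m _ *m _) 0 0).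
  by apply/matrixP => i j; rewrite !mxE.
by apply/matrixP => i j; rewrite !mxE conjCK.
Qed.

Lemma psd_diag_ge0 (C : numClosedFieldType) (n : nat) (A : 'M[C]_n) (i : 'I_n) :
  psd A -> 0 <= A i i.
Proof.
case=> _ /(_ (delta_mx i 0)); congr (is_true (0 <= _)).
have -> : adj (delta_mx i 0 : 'cV[C]_n) = delta_mx 0 i.
  by apply/matrixP => k l; rewrite !mxE andbC rmorph_nat.
by rewrite -rowE -colE !mxE.
Qed.

Lemma psd_mxtrace_ge0 (C : numClosedFieldType) (n : nat) (A : 'M[C]_n) :
  psd A -> 0 <= \tr A.
Proof. by move=> pA; rewrite sumr_ge0 // => i _; apply: psd_diag_ge0. Qed.

Lemma psd_mxtraceM_ge0 (C : numClosedFieldType) (n : nat) (A B : 'M[C]_n) :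
  psd A -> psd B -> 0 <= \tr (A *m B).
Proof.
move=> pA pB.
have hB : B \is hermsymmx.
  by apply/is_hermitianmxP; rewrite expr0 scale1r -[LHS](proj1 pB) adjE.
have /orthomx_spectralP := hermitian_normalmx hB.
have uP := spectral_unitarymx B.
set P := spectralmx B in uP *; set D := spectral_diag B.
rewrite invmx_unitary // -adjE => eB.
have PP : P *m adj P = 1%:M by rewrite adjE; apply/unitarymxP.
have D_ge0 i : 0 <= D 0 i.
  have := psd_diag_ge0 i (psd_congr (adj P) pB).
  rewrite eB adjK !mulmxA PP mul1mx -mulmxA PP mulmx1.
  by rewrite !mxE eqxx mulr1n.
rewrite eB !mulmxA mxtrace_mulC !mulmxA mxtrace_mulC mul_diag_mx.
rewrite sumr_ge0 // => i _; rewrite mxE mulr_ge0 //.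
by have := psd_diag_ge0 i (psd_congr (adj P) pA); rewrite adjK.
Qed.

(** With [Z = 1 - X], which commutes with [X], one has [X - X^2 = XZ = XZ(X + Z) = XZX + ZXZ]. *)
Lemma effect_psd_subsq (C : numClosedFieldType) (n : nat) (X : 'M[C]_n) :
  effect X -> psd (X - X *m X).
Proof.
case=> pX pY; have [aX aY] := (proj1 pX, proj1 pY).
have -> : X - X *m X =
    adj X *m (1%:M - X) *m X + adj (1%:M - X) *m X *m (1%:M - X).
  rewrite aX aY !(mulmxBl, mulmxBr, mul1mx, mulmx1).
  by rewrite [RHS]addrC subrK.
by apply: psdD; apply: psd_congr.
Qed.

Lemma effect_tr (C : numClosedFieldType) (n : nat) (X : 'M[C]_n) :
  effect X -> effect X^T.
Proof.
case=> pX pY; split; first exact: psd_tr.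
by have := psd_tr pY; rewrite linearB /= trmx1.
Qed.

Lemma meas_effect (C : numClosedFieldType) (n : nat) (M : 'I_2 -> 'M[C]_n) :
  is_meas M -> effect (M 0) /\ M 1 = 1%:M - M 0.
Proof.
case=> pM; rewrite big_ord_recl big_ord1.
have -> : lift ord0 ord0 = 1 :> 'I_2 by apply: val_inj.
move=> sM; have e1 : M 1 = 1%:M - M 0 by rewrite -sM addrC addKr.
by split=> //; split=> //; rewrite -e1.
Qed.

(** * The cubic sum-of-squares trace bound *)

Lemma mxtrace_mul_sq (C : numClosedFieldType) (n : nat) (X P Q R : 'M[C]_n)
    (c0 c1 c2 c3 : C) :
  let l := c0 *: 1%:M + c1 *: P + c2 *: Q + c3 *: R in
  let t A := \tr (X *m A) in
  t (l *m l) = c0 ^+ 2 * \tr X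
    + 2 * c0 * (c1 * t P + c2 * t Q + c3 * t R)
    + c1 ^+ 2 * t (P *m P) + c2 ^+ 2 * t (Q *m Q) + c3 ^+ 2 * t (R *m R)
    + c1 * c2 * (t (P *m Q) + t (Q *m P))
    + c1 * c3 * (t (P *m R) + t (R *m P))
    + c2 * c3 * (t (Q *m R) + t (R *m Q)).
Proof.
rewrite /= !(mulmxDl, mulmxDr, =^~ scalemxAl, =^~ scalemxAr, mulmx1, mul1mx).
rewrite !(mxtraceD, mxtraceZ); ring.
Qed.

(* The right-hand side is the expansion of [tr (X (c0 + c1 P + c2 Q + c3 R)^2)]
   with [P^2], [Q^2], [R^2] replaced by the larger [P], [Q], [R]. *)
Lemma effect_sos (C : numClosedFieldType) (n : nat) (X P Q R : 'M[C]_n)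
    (c0 c1 c2 c3 : C) :
  psd X -> effect P -> effect Q -> effect R ->
  c0 \is Num.real -> c1 \is Num.real -> c2 \is Num.real -> c3 \is Num.real ->
  0 <= c0 ^+ 2 * \tr X
    + 2 * c0 * (c1 * \tr (X *m P) + c2 * \tr (X *m Q) + c3 * \tr (X *m R))
    + c1 ^+ 2 * \tr (X *m P) + c2 ^+ 2 * \tr (X *m Q) + c3 ^+ 2 * \tr (X *m R)
    + c1 * c2 * (\tr (X *m (P *m Q)) + \tr (X *m (Q *m P)))
    + c1 * c3 * (\tr (X *m (P *m R)) + \tr (X *m (R *m P)))
    + c2 * c3 * (\tr (X *m (Q *m R)) + \tr (X *m (R *m Q))).
Proof.
move=> pX eP eQ eR r0 r1 r2 r3; pose t A := \tr (X *m A).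
pose l := c0 *: 1%:M + c1 *: P + c2 *: Q + c3 *: R.
have al : adj l = l.
  rewrite !adjD !adjZ adj1 (proj1 eP.1) (proj1 eQ.1) (proj1 eR.1).
  by rewrite !conj_Creal.
have sq : 0 <= t (l *m l).
  by apply: psd_mxtraceM_ge0 => //; rewrite -[X in psd (X *m _)]al; apply: psd_gram.
have sub c Y : c \is Num.real -> effect Y -> 0 <= c ^+ 2 * (t Y - t (Y *m Y)).
  move=> rc eY; rewrite mulr_ge0 ?real_exprn_even_ge0 //.
  rewrite /t -raddfB -mulmxBr; apply: psd_mxtraceM_ge0 => //.
  exact: effect_psd_subsq.
rewrite [t (l *m l)]mxtrace_mul_sq /= -/t in sq.
have := addr_ge0 (addr_ge0 (addr_ge0 sq (sub _ _ r1 eP)) (sub _ _ r2 eQ))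
  (sub _ _ r3 eR).
congr (is_true (0 <= _)); ring.
Qed.

Lemma effect_trace_bound (C : numClosedFieldType) (n : nat)
    (X X' Y Y' : 'M[C]_n) :
  effect X -> effect X' -> effect Y -> effect Y' ->
  \tr (X *m Y) + \tr (X *m Y') + \tr (X' *m Y) - \tr (X' *m Y')
    <= ((sqrtC 2)^-1 + 2^-1) * (\tr X + \tr Y).
Proof.
move=> eX eX' eY eY'.
set r := sqrtC 2.
have r_gt0 : 0 < r by rewrite sqrtC_gt0.
have rr : r ^+ 2 = 2 by rewrite sqrtCK.
have -> : r^-1 = r / 2 by rewrite -rr; field; rewrite gt_eqF.
have rR : r \is Num.real by rewrite gtr0_real.
have k_gt0 : 0 < 4 * (1 + r) by rewrite mulr_gt0 ?addr_gt0.
rewrite -subr_ge0 -(pmulr_rge0 _ k_gt0).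
have [r1 r2] : 1 + r \is Num.real /\ 1 + r / 2 \is Num.real.
  by rewrite !(realD, realM, realV, real1, realn, rR).
have [r3 r4] : 1 - r \is Num.real /\ - r \is Num.real.
  by rewrite !(realB, realN, real1, rR).
have [r5 r6] : 1 \is @Num.real C /\ - 1 \is @Num.real C.
  by rewrite !(realN, real1).
have r7 : 0 \is @Num.real C by exact: real0.
(* The six squares of the certificate: [h1], [h2] carry the weight [X], [h3], [h4] the weight [Y],
   and [h5], [h6] the weights [X'] and [Y']. A zero coefficient drops a term from the square. *)
have h1 := effect_sos (proj1 eX) eX' eY eY' r1 r7 r4 r4.
have h2 := effect_sos (proj1 eX) eX' eY eY' r2 r6 r7 r4.
have h3 := effect_sos (proj1 eY) eY' eX eX' r1 r7 r4 r4.
have h4 := effect_sos (proj1 eY) eY' eX eX' r2 r6 r7 r4.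
have h5 := effect_sos (proj1 eX') eX eY eY' r7 r5 r3 r6.
have h6 := effect_sos (proj1 eY') eY eX eX' r7 r5 r3 r6.
have two : 0 <= 2 :> C by [].
have w : 0 <= 2 * (1 + r) by rewrite mulr_ge0 // addr_ge0 // ltW.
have := addr_ge0 (addr_ge0 (addr_ge0 h1 h3)
  (addr_ge0 (mulr_ge0 two h2) (mulr_ge0 two h4)))
  (addr_ge0 (mulr_ge0 w h5) (mulr_ge0 w h6)).
(* Triple products are brought to one representative per cyclic class; their coefficients then
   cancel by [r^2 = 2]. *)
have cyc (A B D : 'M[C]_n) : \tr (A *m (B *m D)) = \tr (B *m (D *m A)).
  by rewrite mxtrace_mulC -mulmxA.
rewrite (cyc Y X X') (cyc Y X Y') (cyc X' X Y) (cyc X' X Y') (cyc Y' X X')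
  (cyc Y' X Y) -(cyc X Y X') -(cyc X Y Y') -(cyc X X' Y) -(cyc X X' Y')
  -(cyc X Y' X') -(cyc X Y' Y) (cyc Y X' Y') (cyc Y' X' Y) -(cyc X' Y Y')
  -(cyc X' Y' Y).
rewrite (mxtrace_mulC Y X) (mxtrace_mulC X' X) (mxtrace_mulC Y' Y)
  (mxtrace_mulC Y' X) (mxtrace_mulC Y X') (mxtrace_mulC Y' X').
congr (is_true (0 <= _)).
by field: rr.
Qed.

(** * Pure bipartite states as amplitude matrices *)

Lemma split_idx_bij (m n : nat) : bijective (@split_idx m n).
Proof.
exact: bij_comp (enum_val_bij _) (Bijective (cast_ordK _) (cast_ordKV _)).
Qed.

(* The amplitudes of a pure bipartite state are stored in a matrix [M]; Bob's
   operators then act on [M] from the right, transposed. *)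
Lemma behav_vecmx (C : numClosedFieldType) (m n : nat) (M : 'M[C]_(m, n))
    (A : 'I_2 -> 'I_2 -> 'M[C]_m) (B : 'I_2 -> 'I_2 -> 'M[C]_n)
    (a b x y : 'I_2) :
  behav (vecmx M *m adj (vecmx M)) A B a b x y
    = \tr (adj M *m A x a *m M *m (B y b)^T).
Proof.
rewrite /behav -mulmxA mxtrace_mulC /mxtrace big_ord1 mxE.
transitivity (\sum_(q : 'I_m * 'I_n) \sum_(p : 'I_m * 'I_n)
    (M p.1 p.2)^* * (A x a p.1 q.1 * B y b p.2 q.2) * M q.1 q.2).
  rewrite (reindex _ (onW_bij _ (split_idx_bij m n))) /=.
  apply: eq_bigr => k _; rewrite !mxE mulr_suml.
  rewrite (reindex _ (onW_bij _ (split_idx_bij m n))) /=.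
  by apply: eq_bigr => l _; rewrite !mxE.
rewrite exchange_big /=.
transitivity (\sum_(j < n) \sum_(i < m)
  \sum_(q : 'I_m * 'I_n) (M i j)^* * (A x a i q.1 * B y b j q.2) * M q.1 q.2).
  by rewrite [RHS]exchange_big pair_bigA.
apply: eq_bigr => j _; rewrite mxE.
transitivity (\sum_(i < m) \sum_(l < n) \sum_(k < m)
  (M i j)^* * (A x a i k * B y b j l) * M k l).
  by apply: eq_bigr => i _; rewrite [RHS]exchange_big pair_bigA.
rewrite exchange_big; apply: eq_bigr => l _; rewrite !mxE.
rewrite exchange_big mulr_suml; apply: eq_bigr => k _; rewrite !mxE mulr_suml.
rewrite mulr_suml; apply: eq_bigr => i _; rewrite !mxE; ring.
Qed.

Lemma mxtrace_vecmx (C : numClosedFieldType) (m n : nat) (M : 'M[C]_(m, n)) :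
  \tr (vecmx M *m adj (vecmx M)) = \tr (adj M *m M).
Proof.
rewrite mxtrace_mulC /mxtrace big_ord1 mxE.
transitivity (\sum_(p : 'I_m * 'I_n) (M p.1 p.2)^* * M p.1 p.2).
  rewrite (reindex _ (onW_bij _ (split_idx_bij m n))) /=.
  by apply: eq_bigr => k _; rewrite !mxE.
rewrite -(pair_bigA _ (fun i j => (M i j)^* * M i j)) exchange_big /=.
by apply: eq_bigr => j _; rewrite mxE; apply: eq_bigr => i _; rewrite mxE.
Qed.

(** Complementing the outcome 1 gives p(0,1|0,1) = p_A(0|0) - p(0,0|0,1), and likewise for Bob. The
    joint terms thus regain coefficient 1, and [tau] multiplies only the two marginals. *)
Lemma S_tau_vecmx (C : numClosedFieldType) (m n : nat) (tau : C)
    (M : 'M[C]_(m, n))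
    (A : 'I_2 -> 'I_2 -> 'M[C]_m) (B : 'I_2 -> 'I_2 -> 'M[C]_n) :
  (forall x, is_meas (A x)) -> (forall y, is_meas (B y)) ->
  let p x y := \tr (adj M *m A x 0 *m M *m (B y 0)^T) in
  S_tau tau (behav (vecmx M *m adj (vecmx M)) A B)
    = p 0 0 + p 0 1 + p 1 0 - p 1 1
      - tau * (\tr (adj M *m A 0 0 *m M) + \tr (adj M *m M *m (B 0 0)^T)).
Proof.
move=> mA mB /=; rewrite /S_tau !behav_vecmx.
have [_ ->] := meas_effect (mB 1). have [_ ->] := meas_effect (mA 1).
rewrite [(1%:M - B 1 0)^T]linearB /= trmx1 !(mulmxBr, mulmxBl, mulmx1).
rewrite ![\tr (_ - _)]raddfB /=; ring.
Qed.

(** * The maximally entangled state *)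

Lemma maxentE (C : numClosedFieldType) (d : nat) :
  maxent C d = vecmx ((sqrtC d%:R)^-1%:M) *m adj (vecmx ((sqrtC d%:R)^-1%:M)).
Proof.
rewrite /maxent; suff -> : maxent_vec C d = vecmx ((sqrtC d%:R)^-1%:M) by [].
by apply/matrixP => k j; rewrite !mxE; case: eqP; rewrite ?mulr1n ?mulr0n.
Qed.

Lemma S_tau_maxent_le0 (C : numClosedFieldType) (tau : C) (d : nat)
    (A B : 'I_2 -> 'I_2 -> 'M[C]_d) :
  (sqrtC 2)^-1 + 2^-1 <= tau ->
  (forall x, is_meas (A x)) -> (forall y, is_meas (B y)) ->
  S_tau tau (behav (maxent C d) A B) <= 0.
Proof.
move=> le_tau mA mB.
have eA x := (meas_effect (mA x)).1.
have eB y := effect_tr (meas_effect (mB y)).1.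
rewrite maxentE S_tau_vecmx //; set s := (sqrtC _)^-1.
have aS : adj (s%:M : 'M[C]_d) = s^*%:M by rewrite adjE tr_scalar_mx map_scalar_mx.
rewrite aS !mul_scalar_mx -!scalemxAl !mul_mx_scalar -!scalemxAl !mul_scalar_mx.
rewrite !mxtraceZ.
have := effect_trace_bound (eA 0) (eA 1) (eB 0) (eB 1).
move: (eA 0).1 (eB 0).1 => /psd_mxtrace_ge0 tA /psd_mxtrace_ge0 tB.
(* The traces of the effects are nonnegative, so raising [tau] above the threshold preserves the
   bound. *)
move=> /le_trans /(_ (ler_wpM2r (addr_ge0 tA tB) le_tau)) h.
have e_ge0 : 0 <= s^* * s by rewrite mulrC mul_conjC_ge0.
rewrite -subr_ge0 in h.
rewrite -oppr_ge0; have := mulr_ge0 e_ge0 h; congr (is_true (0 <= _)); ring.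
Qed.

(** * A two-qubit state with positive Bell value *)

Lemma trmx_gram (C : numClosedFieldType) (m n : nat) (A : 'M[C]_(m, n)) :
  (adj A *m A)^T = A^T *m adj A^T.
Proof.
by rewrite trmx_mul; congr (_ *m _); apply/matrixP => i j; rewrite !mxE.
Qed.

(** Both operators have rank at most one, so cyclicity collapses the trace to a 1 x 1 matrix times
    its adjoint: the probability is a squared amplitude. *)
Lemma mxtrace_rank1 (C : numClosedFieldType) (m n : nat) (M : 'M[C]_(m, n))
    (u : 'rV[C]_m) (v : 'rV[C]_n) :
  \tr (adj M *m (adj u *m u) *m M *m (adj v *m v)^T)
    = `|(u *m M *m v^T) 0 0| ^+ 2.
Proof.
rewrite trmx_gram normCK -[RHS](_ : \tr (u *m M *m v^T *m adj (u *m M *m v^T)) = _).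
  by rewrite [RHS]mxtrace_mulC !adjM !mulmxA [LHS]mxtrace_mulC !mulmxA.
by rewrite /mxtrace big_ord1 mxE big_ord1 !mxE.
Qed.

Lemma mxtrace_gram (C : numClosedFieldType) (m n : nat) (M : 'M[C]_(m, n)) :
  \tr (M *m adj M) = \sum_i \sum_j `|M i j| ^+ 2.
Proof.
apply: eq_bigr => i _; rewrite mxE; apply: eq_bigr => j _.
by rewrite mxE normCK.
Qed.

(** An orthonormal basis when [s], [t] are real with [s^2 + t^2 = 1]. *)
Definition qubit_vec (C : numClosedFieldType) (s t : C) (a : 'I_2) : 'rV[C]_2 :=
  \row_j if a == 0 then (if j == 0 then s else t)
         else (if j == 0 then t else - s).

Definition qubit_meas (C : numClosedFieldType) (s t : C) (a : 'I_2) : 'M[C]_2 :=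
  adj (qubit_vec s t a) *m qubit_vec s t a.

Lemma qubit_measP (C : numClosedFieldType) (s t : C) :
  s \is Num.real -> t \is Num.real -> s ^+ 2 = 1 - t ^+ 2 ->
  is_meas (qubit_meas s t).
Proof.
move=> rs rt st1; split=> [a|]; first exact: psd_gram.
rewrite !big_ord_recl big_ord0; apply/matrixP => i j.
case: i => [[|[|//]] ?]; case: j => [[|[|//]] ?];
  rewrite !(mxE, big_ord_recl, big_ord0) /= ?rmorphN /= ?conj_Creal //;
  ring: st1.
Qed.

Lemma quantum_value_gt0 (C : numClosedFieldType) (tau : C) :
  1 <= tau -> tau < 3 / 2 -> exists2 v, 0 < v & quantum_value tau v.
Proof.
move=> tau1 tau3.
have p2 : 0 < 2^-1 :> C by rewrite invr_gt0.
(* The Bell value will be [nu^2 t^4 (s^2 + 2 - 2 tau) = nu^2 t^4 (3 - 2 tau - t^2)], positive for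
   [0 < t^2 < 3 - 2 tau]; [t^2] is taken at the midpoint of this range. *)
pose s := sqrtC (tau - 2^-1); pose t := sqrtC (3 / 2 - tau).
have s2 : s ^+ 2 = tau - 2^-1 by rewrite sqrtCK.
have t2 : t ^+ 2 = 3 / 2 - tau by rewrite sqrtCK.
have s_ge0 : 0 <= s.
  rewrite sqrtC_ge0 subr_ge0 (le_trans _ tau1) // invf_le1 ?ler1n //.
have t_gt0 : 0 < t by rewrite sqrtC_gt0 subr_gt0.
(* Normalisation: the unscaled amplitudes [0, t, t, -s] have squared norm
   [2 t^2 + s^2 = 1 + t^2]. *)
pose nu := (sqrtC (1 + t ^+ 2))^-1.
have n_gt0 : 0 < 1 + t ^+ 2 by rewrite addr_gt0 ?exprn_gt0.
have nu_gt0 : 0 < nu by rewrite invr_gt0 sqrtC_gt0.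
have nu2 : nu ^+ 2 * (1 + t ^+ 2) = 1.
  by rewrite exprVn sqrtCK mulVf ?gt_eqF.
have rs : s \is Num.real by rewrite ger0_real.
have rt : t \is Num.real by rewrite gtr0_real.
have rnu : nu \is Num.real by rewrite gtr0_real.
have st1 : s ^+ 2 = 1 - t ^+ 2 by rewrite s2 t2; field.
(* Hardy-type choice: with u = (s, t) and v = (1, 0), M u^T is proportional to
   v^T while v M v^T = 0. *)
pose M : 'M[C]_2 := \matrix_(i, j)
  if (i == 0) && (j == 0) then 0 else if (i == 0) || (j == 0) then nu * t
  else - (nu * s).
pose A (x : 'I_2) := if x == 0 then qubit_meas s t else qubit_meas 1 0.
have mA x : is_meas (A x).
  rewrite /A; case: ifP => _; apply: qubit_measP => //.
  by rewrite expr1n expr0n subr0.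
exists (S_tau tau (behav (vecmx M *m adj (vecmx M)) A A)); last first.
  exists 2, 2, (vecmx M *m adj (vecmx M)), A, A; split; last by [].
  split; first by rewrite -[X in X *m _]adjK; exact: psd_gram.
  rewrite mxtrace_vecmx /mxtrace !(mxE, big_ord_recl, big_ord0) /=.
  rewrite rmorph0 rmorphN !rmorphM /= !conj_Creal // -[RHS]nu2.
  ring: st1.
rewrite S_tau_vecmx // /A /= /qubit_meas !mxtrace_rank1.
set u := qubit_vec s t 0; set v := qubit_vec 1 0 0.
have uM : u *m M = \row_j if j == 0 then nu * t ^+ 2 else 0.
  apply/rowP => j; rewrite !(mxE, big_ord_recl, big_ord0) /=.
  by case: j => [[|[|//]] ?] /=; ring.
have Mu : M *m u^T = \col_j if j == 0 then nu * t ^+ 2 else 0.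
  apply/colP => j; rewrite !(mxE, big_ord_recl, big_ord0) /=.
  by case: j => [[|[|//]] ?] /=; ring.
have vMv : (v *m M *m v^T) 0 0 = 0.
  rewrite !(mxE, big_ord_recl, big_ord0) /=; ring.
have vMu : (v *m M *m u^T) 0 0 = nu * t ^+ 2.
  rewrite -mulmxA Mu !(mxE, big_ord_recl, big_ord0) /=; ring.
have uMv : (u *m M *m v^T) 0 0 = nu * t ^+ 2.
  rewrite uM !(mxE, big_ord_recl, big_ord0) /=; ring.
have uMu : (u *m M *m u^T) 0 0 = nu * t ^+ 2 * s.
  rewrite uM !(mxE, big_ord_recl, big_ord0) /=; ring.
(* Outcome [u] for one party steers the other to [v], so each marginal equals the joint probability
   of [u] and [v]. *)
have -> : \tr (adj M *m (adj u *m u) *m M) = nu ^+ 2 * t ^+ 4.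
  rewrite !mulmxA -adjM -mulmxA mxtrace_mulC uM mxtrace_gram.
  rewrite !(mxE, big_ord_recl, big_ord0) /= normr0 real_normK ?realM ?realX //.
  ring.
have -> : \tr (adj M *m M *m (adj u *m u)^T) = nu ^+ 2 * t ^+ 4.
  rewrite trmx_gram -mulmxA mxtrace_mulC !mulmxA -[_ *m adj M]mulmxA -adjM Mu mxtrace_gram.
  rewrite !(mxE, big_ord_recl, big_ord0) /= normr0 real_normK ?realM ?realX //.
  ring.
rewrite uMu uMv vMu vMv normr0 !real_normK ?realM ?realX //.
have -> : tau = 3 / 2 - t ^+ 2 by rewrite t2 subKr.
rewrite [X in 0 < X](_ : _ = nu ^+ 2 * t ^+ 6); last by field: st1.
by rewrite mulr_gt0 ?exprn_gt0.
Qed.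

Theorem theorem1 (C : numClosedFieldType) (tau : C) :
  (sqrtC 2)^-1 + 2^-1 <= tau -> tau < 3 / 2 ->
  forall (d : nat), (0 < d)%N ->
  forall (A : 'I_2 -> 'I_2 -> 'M[C]_d) (B : 'I_2 -> 'I_2 -> 'M[C]_d),
    (forall x, is_meas (A x)) -> (forall y, is_meas (B y)) ->
    ~ is_SQ tau (S_tau tau (behav (maxent C d) A B)).
Proof.
move=> le_tau lt_tau d _ A B mA mB [_ max].
(* The threshold is at least 1 because [sqrt 2 <= sqrt (2^2) = 2]. *)
have tau1 : 1 <= tau.
  apply: le_trans le_tau; rewrite -lerBlDr (_ : 1 - 2^-1 = 2^-1); last by field.
  rewrite lef_pV2 ?posrE ?sqrtC_gt0 // -[X in _ <= X]sqrCK //.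
  by rewrite ler_sqrtC ?qualifE /= ?exprn_ge0 ?ler0n // expr2 ler_peMl // ler1n.
have [v v_gt0 /max le_v] := quantum_value_gt0 tau1 lt_tau.
by have := lt_le_trans v_gt0 (le_trans le_v (S_tau_maxent_le0 le_tau mA mB));
  rewrite ltxx.
Qed.
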